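(* There exists a finite colouring of $\mathbb{N}^{(2)}$ such that there does not exist a sequence of natural numbers $(y_k)_{k\ge1}$ for which all pairs of the form $(y_1+y_{k_1}+y_{k_2}+\cdots+y_{k_t},\ y_1+y_2+y_3+\cdots+y_{k_{t+1}})$, for all $t\ge0$ and all $2\le k_1<k_2<\cdots<k_{t+1}$, have the same colour.
   Context: $\mathbb{N}^{(2)}$ denotes the set of pairs $(a,b)$ of natural numbers with $a<b$; natural numbers here are positive integers, so each pair above has first coordinate strictly smaller than the second. Equivalently, the forbidden configuration is: all pairs $(\sum_{i\in S}y_i,\ \sum_{i=1}^{m}y_i)$ with $S$ a finite set of indices containing $1$ and $m>\max S$ have the same colour. *)

(* Defs.v *)
From mathcomp Require Import all_boot.

Set Implicit Arguments.
Unset Strict Implicit.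
Unset Printing Implicit Defensive.

(* Natural numbers are positive, so both coordinates are at least 1. *)
Definition natpair := {p : nat * nat | 0 < p.1 < p.2}.

(* Sequences are indexed from 1: the value y 0 is never used. *)
Definition positive_seq (y : nat -> nat) : Prop := forall k, 0 < k -> 0 < y k.

(* 2 <= k_1 < ... < k_t < k_(t+1), where ks = [:: k_1; ...; k_t] may be empty
   and l = k_(t+1). *)
Definition increasing_indices (ks : seq nat) (l : nat) : bool :=
  path ltn 1 (rcons ks l).

Definition sum_pair (y : nat -> nat) (ks : seq nat) (l : nat) : nat * nat :=
  (y 1 + \sum_(k <- ks) y k, \sum_(1 <= i < l.+1) y i).

Lemma sum_pair_lt (y : nat -> nat) (ks : seq nat) (l : nat) :
  positive_seq y -> increasing_indices ks l ->
  0 < (sum_pair y ks l).1 < (sum_pair y ks l).2.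
Proof.
move=> ypos ksl; rewrite /= addn_gt0 ypos //=.
pose S a := \sum_(1 <= i < a.+1) y i.
have step a k : 0 < a -> a < k -> S a + y k <= S k.
  case: k => // k a0 ak; rewrite /S [leqRHS]big_nat_recr //= leq_add2r.
  by rewrite [leqRHS](@big_cat_nat _ _ _ a.+1) //= leq_addr.
suff main a : 0 < a -> path ltn a (rcons ks l) -> S a + \sum_(k <- ks) y k < S l.
  by have := main 1 isT ksl; rewrite {1}/S big_nat1.
elim: ks a {ksl} => [|k ks IH] a a0 /=.
  rewrite andbT big_nil addn0 => al.
  apply: leq_trans (step _ _ a0 al).
  by rewrite -addn1 leq_add2l ypos // (ltn_trans a0 al).
case/andP=> ak /(IH _ (ltn_trans a0 ak)); apply: leq_ltn_trans.
by rewrite big_cons addnA leq_add2r step.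
Qed.

Definition sum_natpair (y : nat -> nat) (ypos : positive_seq y)
    (ks : seq nat) (l : nat) (ksl : increasing_indices ks l) : natpair :=
  exist _ (sum_pair y ks l) (sum_pair_lt ypos ksl).

(* Main.v *)
(* Idea.  For a < b put d = b - a and follow, as i grows, whether
   a mod 2^i < d mod 2^i; colour (a, b) by the number of times this changes,
   modulo 4.  Let S_m = y_1 + ... + y_m, take a 2-adic cluster point rho of (S_m)
   and indices chosen sparsely, so that S_m agrees with rho far beyond the size of
   the previously chosen terms.  For a = S_p - S_q + S_r with p < q < r, the number
   of changes for (a, S_m) splits into the number for (S_p, S_m) and contributions
   R_q and R_r: each comes from its own range of binary digits, and the middle one
   is unaffected by the exchange of a and d.  All pairs having the same colour
   forces R_q + R_r = 0 modulo 4 for all q < r, hence 2 R_q = 0, although R_q is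
   odd.  The contributions R_q do not depend on the other indices because the
   borrows do not: they always occur when rho is a natural number, and never
   otherwise. *)
Require Import Defs.
From mathcomp Require Import all_boot.
From mathcomp Require Import zify.
From Stdlib Require Import Classical ClassicalEpsilon.

Set Implicit Arguments.
Unset Strict Implicit.
Unset Printing Implicit Defensive.

(** * Changes in the comparison of residues *)

Definition lt_mod (i a d : nat) : bool := a %% 2 ^ i < d %% 2 ^ i.

Definition switches (m n a d : nat) : nat :=
  \sum_(m <= i < n) (lt_mod i a d (+) lt_mod i.+1 a d).

Lemma switches_cat k m n a d : m <= k <= n ->
  switches m n a d = switches m k a d + switches k n a d.
Proof. by case/andP=> mk kn; rewrite /switches (@big_cat_nat _ _ _ k). Qed.

(** The constant [g] cancels from each summand; [g = true] serves to absorb an exchange of [a] and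
    [d]. *)
Lemma switches_addb g m n a d a' d' :
  (forall i, m <= i <= n -> lt_mod i a d = g (+) lt_mod i a' d') ->
  switches m n a d = switches m n a' d'.
Proof.
move=> E; apply: eq_big_nat => i /andP[mi iltn].
by rewrite !E ?mi ?(ltnW iltn) ?(leqW mi) // addbACA addbb.
Qed.

Lemma switches_const v m n a d :
  (forall i, m <= i <= n -> lt_mod i a d = v) -> switches m n a d = 0.
Proof.
move=> E; rewrite /switches big_nat big1 // => i /andP[mi iltn].
by rewrite !E ?mi ?(ltnW iltn) ?(leqW mi) // addbb.
Qed.

(** Modulo 2 the sum telescopes. *)
Lemma odd_switches m n a d : m <= n ->
  odd (switches m n a d) = lt_mod m a d (+) lt_mod n a d.
Proof.
elim: n => [|n IH]; first by rewrite leqn0 => /eqP->; rewrite /switches big_geq ?addbb.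
rewrite leq_eqVlt => /predU1P[->|mn]; first by rewrite /switches big_geq ?addbb.
by rewrite /switches big_nat_recr //= oddD oddb -/(switches _ _ _ _) IH // addbA addbK.
Qed.

(** * Residues modulo powers of two *)

Lemma eq_mod_pow2 i K a b : i <= K -> a = b %[mod 2 ^ K] -> a = b %[mod 2 ^ i].
Proof.
by move=> iK E; rewrite -(modn_dvdm a (dvdn_exp2l 2 iK)) E modn_dvdm ?dvdn_exp2l.
Qed.

Lemma leq_mod_pow2 i K x : K <= i -> x %% 2 ^ K <= x %% 2 ^ i.
Proof. by move=> Ki; rewrite -(modn_dvdm x (dvdn_exp2l 2 Ki)) leq_mod. Qed.

Lemma eq_lt_mod i K a a' d d' : i <= K ->
  a = a' %[mod 2 ^ K] -> d = d' %[mod 2 ^ K] -> lt_mod i a d = lt_mod i a' d'.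
Proof. by move=> iK Ea Ed; rewrite /lt_mod (eq_mod_pow2 iK Ea) (eq_mod_pow2 iK Ed). Qed.

Lemma eq_modB D b a a' : a <= b -> a' <= b ->
  a = a' %[mod D] -> b - a = b - a' %[mod D].
Proof.
move=> ab a'b E; apply/eqP; rewrite -(eqn_modDr a) subnK //.
by rewrite -modnDmr E modnDmr subnK.
Qed.

Lemma lt_mod_swap i K a d : K <= i ->
  a %% 2 ^ K != d %% 2 ^ K -> lt_mod i d a = ~~ lt_mod i a d.
Proof.
move=> Ki ne; rewrite /lt_mod -leqNgt ltn_neqAle.
suff -> : d %% 2 ^ i != a %% 2 ^ i by [].
by apply: contra ne => /eqP/(eq_mod_pow2 Ki) ->.
Qed.

Lemma modn_pow2_decomp i K x : K <= i ->
  x %% 2 ^ i = (x %/ 2 ^ K) %% 2 ^ (i - K) * 2 ^ K + x %% 2 ^ K.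
Proof.
move=> Ki; rewrite {1}(divn_eq x (2 ^ K)).
rewrite {1}(divn_eq (x %/ 2 ^ K) (2 ^ (i - K))) mulnDl -mulnA -expnD subnK // -addnA.
rewrite modnMDl modn_small // -{2}(subnK Ki) expnD.
have := ltn_pmod (x %/ 2 ^ K) (expn_gt0 2 (i - K)).
have := ltn_pmod x (expn_gt0 2 K); move: (_ %% 2 ^ K) (_ %% 2 ^ (i - K)) => u v.
by nia.
Qed.

Lemma ltn_lexi D u v x y : y < x < D -> (u * D + x < v * D + y) = (u < v).
Proof.
case/andP=> yx xD; case: (leqP v u) => [vu|uv].
  by apply/negbTE; rewrite -leqNgt; apply: leq_add (ltnW yx); rewrite leq_mul2r vu orbT.
apply: leq_trans (leq_addr _ _); apply: (@leq_trans (u.+1 * D)).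
  by rewrite mulSn addnC ltn_add2r.
by rewrite leq_mul2r uv orbT.
Qed.

(** * Borrows in subtraction *)

Section Borrow.
Variable b : nat.

(** This fits [P] into the lowest [K] digits and settles its comparison with [b - P] from level [K]
    on. *)
Definition small (K P : nat) : bool := P < (b - P) %% 2 ^ K.

Lemma small_lt_pow2 K P : small K P -> P < 2 ^ K.
Proof. by move/ltn_trans; apply; rewrite ltn_pmod ?expn_gt0. Qed.

Lemma small_lt_mod i K P : K <= i -> small K P -> lt_mod i P (b - P).
Proof.
move=> Ki sP; apply: leq_ltn_trans (leq_mod _ _) _.
exact: leq_trans sP (leq_mod_pow2 _ Ki).
Qed.

Lemma modn_small_shift K S P : P <= S <= b -> S = b %[mod 2 ^ K] -> small K P ->
  (S - P) %% 2 ^ K = (b - P) %% 2 ^ K /\ (b - (S - P)) %% 2 ^ K = P.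
Proof.
case/andP=> PS Sb E sP; have E1 : S - P = b - P %[mod 2 ^ K].
  by apply/eqP; rewrite -(eqn_modDr P) !subnK ?E ?(leq_trans PS).
split=> //; rewrite (@eq_modB _ _ _ (b - P)) ?leq_subr ?(leq_trans (leq_subr _ _)) //.
by rewrite subKn ?(leq_trans PS) // modn_small ?small_lt_pow2.
Qed.

(** The low digits are [(b - P) %% 2 ^ K] on the left and the smaller [P] on the right, so the
    digits above [K] decide and a tie there counts as false. [P] reaches those digits only as a
    borrow on the left; on the right it fits below them. *)
Lemma lt_mod_shift i K S P : K <= i -> P <= S <= b -> S = b %[mod 2 ^ K] ->
    small K P ->
  lt_mod i (S - P) (b - (S - P)) =
  ((S %/ 2 ^ K - (b %% 2 ^ K < P)) %% 2 ^ (i - K)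
     < (b - S) %/ 2 ^ K %% 2 ^ (i - K)).
Proof.
move=> Ki PSb E sP; have [Ea Ed] := modn_small_shift PSb E sP.
have ltP := small_lt_pow2 sP; case/andP: PSb => PS Sb.
have K0 : 0 < 2 ^ K by rewrite expn_gt0.
rewrite /lt_mod (modn_pow2_decomp (S - P) Ki) (modn_pow2_decomp (b - (S - P)) Ki) Ea Ed.
rewrite divnB // [P %/ _]divn_small // subn0 (modn_small ltP) E.
have -> : (b - (S - P)) %/ 2 ^ K = (b - S) %/ 2 ^ K.
  have -> : b - (S - P) = b - S + P by rewrite subnBA // addnBAC.
  have /dvdnP[t ->] : 2 ^ K %| b - S by rewrite -eqn_mod_dvd // E.
  by rewrite divnMDl // (divn_small ltP) addn0 mulnK.
by rewrite ltn_lexi // ltn_pmod // andbT.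
Qed.

Lemma lt_mod_shift_eq i K S P e : K <= i -> P <= S <= b -> e <= S ->
    S = b %[mod 2 ^ K] -> small K P -> small K e ->
    (b %% 2 ^ K < P) = (b %% 2 ^ K < e) ->
  lt_mod i (S - P) (b - (S - P)) = lt_mod i (S - e) (b - (S - e)).
Proof.
move=> Ki /andP[PS Sb] eS E sP se Eb.
by rewrite !(lt_mod_shift Ki) ?PS ?Sb ?eS // Eb.
Qed.

End Borrow.

(** * Splitting the count for an alternating sum *)

Definition same_borrow b K P e := (b %% 2 ^ K < P) = (b %% 2 ^ K < e).

(* The offset e replaces the tail S1, resp. S2 - S1, that is subtracted below the
   digits of S2, resp. S3: only whether it causes a borrow at K1, resp. K2, matters. *)
Lemma switches_alternating b e K1 K2 S1 S2 S3 :
    K1 <= K2 -> K2 <= b -> S1 <= S2 <= S3 -> S3 <= b -> e <= S2 ->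
    (forall i, i <= K2 -> e %% 2 ^ i <= (b - e) %% 2 ^ i) ->
    S2 = b %[mod 2 ^ K1] -> S3 = b %[mod 2 ^ K2] ->
    small b K1 S1 -> small b K1 e -> same_borrow b K1 S1 e ->
    small b K2 (S2 - S1) -> small b K2 e -> same_borrow b K2 (S2 - S1) e ->
    small b K2 (S2 - e) ->
  switches 0 b (S3 - (S2 - S1)) (b - (S3 - (S2 - S1))) =
  switches 0 b S1 (b - S1) + switches 0 b (S2 - e) (b - (S2 - e))
  + switches 0 b (S3 - e) (b - (S3 - e)).
Proof.
move=> K12 K2b /andP[S12 S23] S3b eS2 start E2 E3 sm1 sme1 sb1 sm2 sme2 sb2 smU.
have K1b := leq_trans K12 K2b.
have E3' := eq_mod_pow2 K12 E3.
set Q := S2 - S1; set a := S3 - Q.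
have QS3 : Q <= S3 := leq_trans (leq_subr _ _) S23.
have ab : a <= b := leq_trans (leq_subr _ _) S3b.
have S1b : S1 <= b := leq_trans S12 (leq_trans S23 S3b).
have aS1 : a = S1 %[mod 2 ^ K1].
  apply/eqP; rewrite -(eqn_modDr S2); have -> : a + S2 = S1 + S3.
    by rewrite /a -{1}(subnK S12) addnA subnK // addnC.
  by rewrite eqn_modDl E2 E3'.
have abQ : a = b - Q %[mod 2 ^ K2].
  by apply/eqP; rewrite -(eqn_modDr Q) !subnK ?E3 ?(leq_trans QS3).
(* Below level [K] the two numbers agree with [b - e] and [e], so by [start] the comparison is
   constantly false. *)
have head K S : K <= K2 -> e <= S <= b -> S = b %[mod 2 ^ K] ->
    switches 0 K (S - e) (b - (S - e)) = 0.
  move=> KK2 /andP[eS Sb] E; apply: (@switches_const false) => i /andP[_ iK].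
  have Ea : S - e = b - e %[mod 2 ^ K].
    by apply/eqP; rewrite -(eqn_modDr e) !subnK ?E ?(leq_trans eS).
  rewrite (@eq_lt_mod _ K _ (b - e) _ e) //.
    by apply/negbTE; rewrite -leqNgt start ?(leq_trans iK).
  rewrite (@eq_modB _ _ _ (b - e)) ?leq_subr ?subKn ?(leq_trans eS) //.
  exact: leq_trans (leq_subr _ _) Sb.
rewrite (@switches_cat K1 0 b) // (@switches_cat K2 K1 b) ?K12 // addnA.
congr (_ + _ + _).
(* Up to [K1], [a] looks like [S1], whose comparison is settled from there on. *)
- rewrite (@switches_cat K1 0 b S1) // [X in _ + X](@switches_const true) ?addn0; last first.
    by move=> i /andP[K1i _]; apply: small_lt_mod sm1.
  apply: (@switches_addb false) => i /andP[_ iK]; rewrite addFb; apply: eq_lt_mod iK _ _ => //.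
  exact: eq_modB.
- rewrite (@switches_cat K1 0 b (S2 - e)) // head ?eS2 ?(leq_trans S23) // add0n.
  rewrite (@switches_cat K2 K1 b (S2 - e)) ?K12 //.
  rewrite [X in _ + X](@switches_const true) ?addn0; last first.
    by move=> i /andP[K2i _]; apply: small_lt_mod smU.
  (* Between [K1] and [K2], [a] looks like [b - Q] and [b - a] like [Q]: the comparison is reversed,
     its changes are not. *)
  apply: (@switches_addb true) => i /andP[K1i iK2].
  rewrite addTb -(@lt_mod_shift_eq b i K1 S2 S1 e) ?S12 ?(leq_trans S23) //.
  rewrite -(@lt_mod_swap i K1) //; last first.
    rewrite (modn_small_shift _ E2 sm1).1 ?(modn_small_shift _ E2 sm1).2 ?S12 ?(leq_trans S23) //.
    by move: sm1; rewrite /small ltn_neqAle eq_sym => /andP[].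
  apply: eq_lt_mod iK2 _ _ => //.
  rewrite (@eq_modB _ _ _ (b - Q)) ?leq_subr // subKn //; exact: leq_trans S3b.
- rewrite (@switches_cat K2 0 b (S3 - e)) // head ?S3b ?andbT ?(leq_trans eS2) // add0n.
  apply: (@switches_addb false) => i /andP[K2i _]; rewrite addFb.
  by rewrite (@lt_mod_shift_eq b i K2 S3 Q e) ?QS3 // (leq_trans eS2).
Qed.

(** * A 2-adic cluster point *)

Lemma exists_2adic_cluster (S : nat -> nat) : exists rho : nat -> nat,
  [/\ forall K, rho K < 2 ^ K, forall i K, i <= K -> rho K %% 2 ^ i = rho i
    & forall K N, exists2 m, N < m & S m %% 2 ^ K = rho K].
Proof.
pose inf K r := forall N, exists2 m, N < m & S m %% 2 ^ K = r.
(* The next binary digit is 0 whenever the residue so obtained recurs infinitely often. *)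
pose rho := fix rho K := if K is k.+1 then
  if excluded_middle_informative (inf k.+1 (rho k)) then rho k else rho k + 2 ^ k
  else 0.
have rhoS K : inf K.+1 (rho K) /\ rho K.+1 = rho K \/
    ~ inf K.+1 (rho K) /\ rho K.+1 = rho K + 2 ^ K.
  by rewrite /=; destruct excluded_middle_informative; [left | right].
have lt_rho K : rho K < 2 ^ K.
  elim: K => // K IH; rewrite expnS; case: (rhoS K) => -[_ ->]; lia.
have rhoSK K : rho K.+1 %% 2 ^ K = rho K.
  by case: (rhoS K) => -[_ ->]; rewrite ?modnDr modn_small.
exists rho; split=> //.
  move=> i; elim=> [|K IH]; first by rewrite leqn0 => /eqP->.
  rewrite leq_eqVlt => /predU1P[->|]; first by rewrite modn_small.
  rewrite ltnS => iK; rewrite -(IH iK) -(rhoSK K) modn_dvdm ?dvdn_exp2l //.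
elim=> [|K IH]; first by move=> N; exists N.+1; rewrite ?modn1.
rewrite -/(inf _ _); case: (rhoS K) => -[ninf ->] // N.
(* Past [N0], the residue [rho K] can lift only with the digit 1. *)
have [N0 hN0] : exists N0, forall m, N0 < m -> S m %% 2 ^ K.+1 <> rho K.
  apply: NNPP => h; apply: ninf => N0; apply: NNPP => h'; apply: h; exists N0 => m mN0 E.
  by apply: h'; exists m.
have [m mN E] := IH (maxn N N0); exists m; first lia.
have {hN0} := hN0 m; move: mN; rewrite gtn_max => /andP[_ ->] /(_ isT).
rewrite (@modn_pow2_decomp K.+1 K) // E subSnn modn2.
by case: odd => //=; lia.
Qed.

(** * The offset and uniform borrows *)

Section Offset.
Variable rho : nat -> nat.
Hypothesis lt_rho : forall K, rho K < 2 ^ K.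
Hypothesis rho_coherent : forall i K, i <= K -> rho K %% 2 ^ i = rho i.

Lemma leq_rho i K : i <= K -> rho i <= rho K.
Proof. by move=> iK; rewrite -(rho_coherent iK) leq_mod. Qed.

(* The offset is 0 when rho is unbounded and A + 1 when rho is the natural number A. *)
Lemma exists_offset : exists e,
  (forall i x, e <= x -> x %% 2 ^ i = rho i -> e %% 2 ^ i <= (x - e) %% 2 ^ i) /\
  forall n K0, exists2 K, K0 <= K & forall P x, e <= P <= n -> P <= x ->
    x %% 2 ^ K = rho K -> small x K P /\ same_borrow x K P e.
Proof.
have [[A hA]|h] := classic (exists A, forall K, rho K = A %% 2 ^ K).
  (* Here [x - A.+1] is -1 modulo [2 ^ i], the largest residue. *)
  exists A.+1; split=> [i x ex Ex|n K0].
    have [t Et] : exists t, x - A = t * 2 ^ i.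
      by apply/dvdnP; rewrite -eqn_mod_dvd ?(ltnW ex) // Ex hA.
    have i0 : 0 < 2 ^ i by rewrite expn_gt0.
    have -> : x - A.+1 = t.-1 * 2 ^ i + (2 ^ i).-1.
      case: t Et => [|t] /=; rewrite ?mulSn; lia.
    by rewrite modnMDl (@modn_small _.-1) ?prednK // -ltnS prednK // ltn_pmod.
  (* Since [2 ^ K] exceeds [n.*2], the residue [2 ^ K + A - P] of [x - P] exceeds [P]. *)
  exists (maxn K0 n.*2); first exact: leq_maxl.
  set K := maxn _ _ => P x /andP[AP Pn] Px Ex.
  have K2n : n.*2 < 2 ^ K by apply: leq_trans (ltn_expl _ (leqnn 2)) _; rewrite leq_exp2l ?leq_maxr.
  have EA : rho K = A by rewrite hA modn_small //; lia.
  rewrite /small /same_borrow Ex EA; split; last by rewrite AP ltnSn.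
  move: (divn_eq x (2 ^ K)); rewrite Ex EA; case: (_ %/ _) => [|t] Et; first lia.
  have -> : x - P = t * 2 ^ K + (2 ^ K + A - P) by rewrite mulSn in Et; lia.
  by rewrite modnMDl modn_small; lia.
(* If [rho] stayed at a value [B], it would be the natural number [B]. *)
have unb B : exists K, B <= rho K.
  elim: B => [|B [K hK]]; first by exists 0.
  move: hK; rewrite leq_eqVlt => /predU1P[EB|]; last by exists K.
  have [K' ne] : exists K', rho K' <> B %% 2 ^ K'.
    by apply: not_all_ex_not => hB; apply: h; exists B.
  exists K'; case: (leqP K' K) => [K'K|KK']; first by case: ne; rewrite EB rho_coherent.
  have := leq_rho (ltnW KK'); rewrite -EB leq_eqVlt => /predU1P[EB'|//].
  by case: ne; rewrite EB' modn_small.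
exists 0; split=> [i x _ _|n K0]; first by rewrite mod0n.
(* With [rho K] above [n.*2], no [P <= n] borrows and [rho K - P] exceeds [P]. *)
have [K1 hK1] := unb n.*2.+1; exists (maxn K0 K1); first exact: leq_maxl.
have := leq_trans hK1 (leq_rho (leq_maxr K0 K1)).
move: (maxn _ _) => K hK P x /= Pn Px Ex; have lK := lt_rho K.
rewrite /small /same_borrow Ex; split; last by lia.
have -> : x - P = x %/ 2 ^ K * 2 ^ K + (rho K - P).
  by rewrite {1}(divn_eq x (2 ^ K)) Ex addnBA //; lia.
by rewrite modnMDl modn_small; lia.
Qed.

End Offset.

(** * The contradiction modulo 4 *)

Lemma switches_not_constant_mod4 (S : nat -> nat) (c : nat) :
    {homo S : m n / m <= n} -> (forall m, m <= S m) ->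
  ~ forall p q r m, 0 < p <= q -> q <= r < m ->
      switches 0 (S m) (S r - (S q - S p)) (S m - (S r - (S q - S p))) = c %[mod 4].
Proof.
move=> Smono leS const.
have [rho [lt_rho coh clu]] := exists_2adic_cluster S.
have [e [start good]] := exists_offset lt_rho coh.
have [j1 j1e _] := clu 0 e.
have [K1 _ good1] := good (S j1) 0.
(* This bound gives [e <= S p - S j1] for all [p >= j2], so that [good] applies to the
   difference. *)
have [j2 j2S E2] := clu K1 (j1 + S j1 + e).
have [K2 K12 good2] := good (S j2) K1.
have [j3 j23 E3] := clu K2 j2.
have [K3 K23 good3] := good (S j3) K2.
have [j4 j34 E4] := clu K3 j3.
(* Taking [m] beyond [K3] gives [K3 <= S m]: all digit ranges lie within the count. *)
have [m mK Em] := clu K3 (maxn j4 K3).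
move: mK; rewrite gtn_max => /andP[j4m K3m].
set b := S m in Em *.
have K3b : K3 <= b := leq_trans (ltnW K3m) (leS m).
have Eb i : i <= K3 -> b %% 2 ^ i = rho i.
  by move=> iK; rewrite -(coh _ _ iK) -Em modn_dvdm ?dvdn_exp2l.
have eS1 : e <= S j1 := leq_trans (ltnW j1e) (leS j1).
have S2 : S j1 + e <= S j2.
  by apply: leq_trans (leS j2); apply: leq_trans (ltnW j2S); rewrite -addnA leq_addl.
have j12 : j1 <= j2.
  by apply: leq_trans (ltnW j2S); rewrite -addnA leq_addr.
have triple K p q : K1 <= K <= K3 -> j2 <= p < q -> q < m ->
    S p = b %[mod 2 ^ K1] -> S q = b %[mod 2 ^ K] ->
    (forall P x, e <= P <= S p -> P <= x -> x %% 2 ^ K = rho K ->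
       small x K P /\ same_borrow x K P e) ->
  small b K (S p - e) /\
  (switches 0 b (S p - e) (b - (S p - e))
   + switches 0 b (S q - e) (b - (S q - e))) %% 4 = 0.
Proof.
  case/andP=> K1K KK3 /andP[j2p pq] qm Ep Eq goodK.
  have S2p := Smono _ _ j2p; have Spq := Smono _ _ (ltnW pq).
  have Sqb : S q <= b := Smono _ _ (ltnW qm).
  have S1p : S j1 <= S p := Smono _ _ (leq_trans j12 j2p).
  have eSp : e <= S p := leq_trans eS1 S1p.
  have j10 : 0 < j1 := leq_ltn_trans (leq0n e) j1e.
  have range : e <= S p - S j1 <= S p /\ e <= S p - e <= S p.
    by clear -S2 S2p eS1; lia.
  have goodP P : e <= P <= S p -> small b K P /\ same_borrow b K P e.
    case/andP=> eP PS; apply: goodK; rewrite ?eP ?Eb //.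
    exact: leq_trans PS (leq_trans Spq Sqb).
  have good1P P : e <= P <= S j1 -> small b K1 P /\ same_borrow b K1 P e.
    case/andP=> eP PS; apply: good1; rewrite ?eP ?Eb ?(leq_trans K1K) //.
    exact: leq_trans PS (leq_trans S1p (leq_trans Spq Sqb)).
  have [|sm1 sb1] := good1P (S j1); first by rewrite eS1 leqnn.
  have [|sme1 _] := good1P e; first by rewrite eS1 leqnn.
  have [sm2 sb2] := goodP (S p - S j1) range.1.
  have [|sme2 _] := goodP e; first by rewrite eSp leqnn.
  have [smU _] := goodP (S p - e) range.2.
  split=> //.
  have j1p : j1 <= p := leq_trans j12 j2p.
  have j1m : j1 < m := leq_ltn_trans j1p (ltn_trans pq qm).
  (* Equal indices give the pair of [S j1] and [S m], whose count cancels from that of the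
     alternating sum. *)
  have := const j1 j1 j1 m; have := const j1 p q m.
  rewrite -/b subnn subn0 (@switches_alternating b e K1 K (S j1) (S p) (S q)) //; last first.
  - by move=> i iK; rewrite start ?Eb ?(leq_trans eSp) ?(leq_trans Spq) ?(leq_trans iK).
  - by rewrite S1p.
  - exact: leq_trans KK3 K3b.
  rewrite j10 j1p (ltnW pq) qm leqnn j1m; move: (switches _ _ _ _) (switches _ _ _ _).
  by move: (switches _ _ _ _) => w u v /(_ isT isT) + /(_ isT isT); clear; lia.
have E2' : S j2 = b %[mod 2 ^ K1] by rewrite E2 Eb // (leq_trans K12).
have E3' : S j3 = b %[mod 2 ^ K2] by rewrite E3 Eb.
have E4' : S j4 = b %[mod 2 ^ K3] by rewrite E4 Em.
have j3m := ltn_trans j34 j4m.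
have j24 := ltn_trans j23 j34.
have K13 := leq_trans K12 K23.
have [sm2 T23] := triple K2 j2 j3 (introT andP (conj K12 K23))
  (introT andP (conj (leqnn _) j23)) j3m E2' E3' good2.
have [_ T24] := triple K2 j2 j4 (introT andP (conj K12 K23))
  (introT andP (conj (leqnn _) j24)) j4m E2' (eq_mod_pow2 K23 E4') good2.
have [_ T34] := triple K3 j3 j4 (introT andP (conj K13 (leqnn _)))
  (introT andP (conj (ltnW j23) j34)) j4m (eq_mod_pow2 K12 E3') E4' good3.
(* The comparison is false at level 0 and true at level [b], so the contribution of [j2] is odd. *)
have := odd_switches (S j2 - e) (b - (S j2 - e)) (leq0n b).
rewrite (small_lt_mod (leq_trans K23 K3b) sm2) {1}/lt_mod !modn1.
move: T23 T24 T34; move: (switches _ _ _ _) (switches _ _ _ _) (switches _ _ _ _) => u v w.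
by clear; lia.
Qed.

(** * Alternating sums of partial sums as admissible pairs *)

Section Indices.
Variable y : nat -> nat.
Hypothesis ypos : positive_seq y.
Let S m := \sum_(1 <= i < m.+1) y i.

Lemma partial_sum_mono : {homo S : m n / m <= n}.
Proof.
move=> m n mn; rewrite /S [leqRHS](@big_cat_nat _ _ _ m.+1) //=; exact: leq_addr.
Qed.

Lemma leq_partial_sum m : m <= S m.
Proof.
elim: m => // m IH; apply: leq_ltn_trans IH _.
by rewrite /S [ltnRHS]big_nat_recr //= -[ltnLHS]addn0 ltn_add2l ypos.
Qed.

Lemma sum_pair_alternating p q r m : 0 < p <= q -> q <= r < m ->
  exists2 ks, increasing_indices ks m & sum_pair y ks m = (S r - (S q - S p), S m).
Proof.
case/andP=> p0 pq /andP[qr rm].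
(* The index 1 is supplied by the summand [y 1]; either block may be empty. *)
exists (index_iota 2 p.+1 ++ index_iota q.+1 r.+1).
  rewrite /increasing_indices -cats1 -catA path_min_sorted; last first.
    by apply/allP => k; rewrite !mem_cat !mem_index_iota inE; lia.
  rewrite (sorted_pairwise ltn_trans) !pairwise_cat -!(sorted_pairwise ltn_trans).
  rewrite !iota_ltn_sorted /= !andbT allrel_catr -andbA.
  by apply/and3P; split; apply/allrelP => u v; rewrite ?mem_index_iota ?inE; lia.
rewrite /sum_pair big_cat /=; congr (_, _).
have ES u v : u <= v -> S v = S u + \sum_(u.+1 <= i < v.+1) y i.
  by move=> uv; rewrite /S (@big_cat_nat _ _ _ u.+1).
have S1 : S 1 = y 1 by rewrite /S big_nat1.
by rewrite addnA -S1 -ES // (ES q r) // (ES p q) //; lia.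
Qed.

End Indices.

Theorem theorem4 :
  exists (r : nat) (c : natpair -> 'I_r),
    ~ exists (y : nat -> nat) (ypos : positive_seq y) (col : 'I_r),
        forall (ks : seq nat) (l : nat) (ksl : increasing_indices ks l),
          c (sum_natpair ypos ksl) = col.
Proof.
(* Levels up to [x.2] suffice: both numbers are below [2 ^ x.2], so no change occurs later. *)
pose T (x : nat * nat) := switches 0 x.2 x.1 (x.2 - x.1).
exists 4, (fun x => Ordinal (ltn_pmod (T (val x)) (isT : 0 < 4))).
case=> y [ypos [col const]].
apply: (@switches_not_constant_mod4 _ col (@partial_sum_mono y) (leq_partial_sum ypos)).
move=> p q r m pq qr; have [ks ksm E] := sum_pair_alternating y pq qr.
have : T (sum_pair y ks m) %% 4 = col := congr1 val (const ks m ksm).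
by rewrite E => ->; rewrite modn_small.
Qed.
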